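(* Let $R$ be a Dedekind domain with a maximal ideal $\mathfrak{p}$ and finite residue field $R/\mathfrak{p} \cong \mathbb{F}_q$. Let $n,r,v_1,\ldots,v_r \in \mathbb{Z}^+$. Let $A_1,\ldots,A_n,B_1,\ldots,B_r \subset R$ be nonempty subsets, each having the property that no two distinct elements are congruent modulo $\mathfrak{p}$. Let $f_1,\ldots,f_r \in R[t_1,\ldots,t_n]$. Put $$Z = \Big\{x \in \prod_{i=1}^n A_i \;\Big|\; \forall\, 1 \le j \le r,\ f_j(x) \in B_j \pmod{\mathfrak{p}^{v_j}}\Big\}.$$ Then $\# Z = 0$ or $$\# Z \ge \mathfrak{m}\Big(\# A_1,\ldots,\# A_n;\ \sum_{i=1}^n \# A_i - \sum_{j=1}^r (q^{v_j}-\# B_j)\deg(f_j)\Big).$$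
   Context: For $n,a_1,\ldots,a_n \in \mathbb{Z}^+$ and an integer $N \le \sum_{i=1}^n a_i$, put $\mathfrak{m}(a_1,\ldots,a_n;N) = 1$ if $N < n$, and, if $n \le N \le \sum_{i=1}^n a_i$, let $\mathfrak{m}(a_1,\ldots,a_n;N)$ be the minimum of $\prod_{i=1}^n y_i$ over all $(y_1,\ldots,y_n) \in \mathbb{Z}^n$ with $1 \le y_i \le a_i$ for all $i$ and $\sum_{i=1}^n y_i = N$. For a ring $R$, a subset $B \subset R$, an ideal $I$ of $R$ and $x \in R$, ''$x \in B \pmod I$'' means that there is $b \in B$ with $x - b \in I$. The sets $A_i$, $B_j$ are automatically finite since $R/\mathfrak{p}$ is finite. $\deg$ denotes total degree; the zero polynomial is assigned degree $0$. *)

(* Defs.v *)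
From mathcomp Require Import all_boot all_order all_algebra.
From mathcomp Require Import finmap.
From mathcomp Require Import boolp classical_sets functions cardinality.
From mathcomp Require Import mpoly.

Set Implicit Arguments.
Unset Strict Implicit.
Unset Printing Implicit Defensive.

Import Order.TTheory GRing.Theory Num.Theory.

Local Open Scope classical_set_scope.
Local Open Scope ring_scope.

(* Ideals are MathComp's [idealr R], which are *proper* ideals given by boolean
   predicates; classically every proper ideal is of this form. *)

(* The unit ideal, which is not an [idealr], is generated by 1. *)
Definition noetherian (R : comNzRingType) : Prop :=
  forall I : idealr R, exists (k : nat) (g : 'I_k -> R), forall x : R,
    x \in I <-> exists c : 'I_k -> R, x = \sum_i c i * g i.

Definition integrally_closed (R : idomainType) : Prop :=
  forall z : {fraction R}, integralOver (@FracField.tofrac R) z ->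
    exists x : R, z = FracField.tofrac x.

Definition maximal_ideal (R : comNzRingType) (I : idealr R) : Prop :=
  forall J : idealr R, {subset I <= J} -> {subset J <= I}.

(* Fields are allowed, as in Neukirch. *)
Definition dedekind_domain (R : idomainType) : Prop :=
  [/\ noetherian R,
      integrally_closed R &
      forall I : prime_idealr R,
        (exists2 x : R, x \in I & x != 0) -> maximal_ideal I].

Definition ideal_mul (R : comNzRingType) (I J : set R) : set R :=
  [set x | exists (k : nat) (a b : 'I_k -> R),
    [/\ forall i, I (a i), forall i, J (b i) & x = \sum_i a i * b i]].

Definition ideal_exp (R : comNzRingType) (I : set R) (v : nat) : set R :=
  iter v (ideal_mul I) setT.

Definition in_mod (R : comNzRingType) (x : R) (B I : set R) : Prop :=
  exists2 b, B b & I (x - b).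

Definition incongruent (R : comNzRingType) (I : idealr R) (A : set R) : Prop :=
  forall x y : R, A x -> A y -> x - y \in I -> x = y.

(* [fset_set A] is empty when A is infinite; [finite_incongruent] and
   [finite_solutions] below show that this does not occur here. *)
Definition set_card (T : choiceType) (A : set T) : nat := #|` fset_set A|.

Definition mdegree (R : comNzRingType) (n : nat) (f : {mpoly R[n]}) : nat :=
  (msize f).-1.

Definition solutions (R : comNzRingType) (p : idealr R) (n r : nat)
    (v : 'I_r -> nat) (A : 'I_n -> set R) (B : 'I_r -> set R)
    (f : 'I_r -> {mpoly R[n]}) : set {ffun 'I_n -> R} :=
  [set x | (forall i, A i (x i)) /\
           forall j, in_mod (f j).@[x] (B j) (ideal_exp [set` p] (v j))].

(* The admissible [y] for the minimum: [y i <= a i <= \sum_i a i], so nothing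
   is lost by letting [y i] range over ['I_(\sum_i a i).+1]. *)
Definition distribution (n : nat) (a : 'I_n -> nat) (N : int)
    (y : {ffun 'I_n -> 'I_(\sum_(i < n) a i)%N.+1}) : bool :=
  [forall i, (1 <= y i <= a i)%N] && ((\sum_(i < n) y i)%N%:Z == N).
Arguments distribution {n} a N y.

(* The default value [\prod_i a i] is an upper bound of the products minimized;
   see [min_distributionP]. *)
Definition min_distribution (n : nat) (a : 'I_n -> nat) (N : int) : nat :=
  if N < n%:Z then 1%N
  else \big[minn/(\prod_(i < n) a i)%N]_(y | distribution a N y)
         (\prod_(i < n) y i)%N.

Lemma finite_incongruent (R : comNzRingType) (I : idealr R) (F : finType)
    (phi : {ideal_quot I} -> F) (A : set R) :
  injective phi -> incongruent I A -> finite_set A.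
Proof.
move=> phiI AI; pose g (x : R) := phi (\pi_({ideal_quot I})%qT x).
have ginj : {in A &, injective g}.
  move=> x y; rewrite !inE => Ax Ay /phiI exy; apply: AI => //.
  by rewrite Quotient.idealrBE; apply/eqP.
by rewrite -(eq_finite_set (inj_card_eq ginj)).
Qed.

Lemma finite_solutions (R : comNzRingType) (p : idealr R) (F : finType)
    (phi : {ideal_quot p} -> F) (n r : nat) (v : 'I_r -> nat)
    (A : 'I_n -> set R) (B : 'I_r -> set R) (f : 'I_r -> {mpoly R[n]}) :
  injective phi -> (forall i, incongruent p (A i)) ->
  finite_set (solutions p v A B f).
Proof.
move=> phiI AI.
pose g (x : {ffun 'I_n -> R}) :=
  [ffun i : 'I_n => phi (\pi_({ideal_quot p})%qT (x i))].
have ginj : {in solutions p v A B f &, injective g}.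
  move=> x y; rewrite !inE => -[Ax _] [Ay _] /ffunP exy; apply/ffunP => i.
  apply: (AI i) => //; rewrite Quotient.idealrBE; apply/eqP/phiI.
  by have := exy i; rewrite !ffunE.
by rewrite -(eq_finite_set (inj_card_eq ginj)).
Qed.

Lemma distribution_exists (n : nat) (a : 'I_n -> nat) (k : nat) :
  (forall i, 0 < a i)%N -> (n + k <= \sum_(i < n) a i)%N ->
  exists y : 'I_n -> nat,
    (forall i, 1 <= y i <= a i)%N /\ (\sum_(i < n) y i = n + k)%N.
Proof.
move=> a_gt0; elim: k => [|k IHk] le_a.
  exists (fun=> 1%N); split=> [i|]; first exact: a_gt0.
  by rewrite sum1_card card_ord addn0.
have [|y [y_le y_sum]] := IHk; first by rewrite (leq_trans _ le_a) ?leq_add.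
have [i lt_i] : exists i, (y i < a i)%N.
  apply/existsP; apply: contraTT le_a; rewrite negb_exists => /forallP ge_a.
  rewrite -ltnNge addnS ltnS -y_sum; apply: leq_sum => i _.
  by rewrite leqNgt ge_a.
exists (fun j => y j + (j == i))%N; split=> [j|].
  have /andP[y1 y2] := y_le j; rewrite (leq_trans y1) ?leq_addr //=.
  by case: eqP => [->|_]; rewrite ?addn1 ?addn0.
rewrite big_split /= y_sum addnS -addn1; congr addn.
by rewrite (bigD1 i) //= eqxx big1 // => j /negbTE ->.
Qed.

Lemma leq_bigminn (I : finType) (P : pred I) (G : I -> nat) (x : nat) (z : I) :
  P z -> (\big[minn/x]_(i | P i) G i <= G z)%N.
Proof.
move=> Pz; have := mem_index_enum z; rewrite unlock.
elim: (index_enum _) => //= w s IHs; rewrite inE => /predU1P[<-|/IHs le_s].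
  by rewrite Pz geq_minl.
by case: ifP => _ //; rewrite (leq_trans (geq_minr _ _)).
Qed.

Lemma min_distributionP (n : nat) (a : 'I_n -> nat) (N : nat) :
  (forall i, 0 < a i)%N -> (n <= N <= \sum_(i < n) a i)%N ->
  (exists y : 'I_n -> nat,
    [/\ forall i, (1 <= y i <= a i)%N, (\sum_(i < n) y i = N)%N &
        (\prod_(i < n) y i = min_distribution a N%:Z)%N]) /\
  (forall y : 'I_n -> nat,
    (forall i, 1 <= y i <= a i)%N -> (\sum_(i < n) y i = N)%N ->
    (min_distribution a N%:Z <= \prod_(i < n) y i)%N).
Proof.
move=> a_gt0 /andP[le_nN le_Na].
have y_lt (y : 'I_n -> nat) : (forall i, 1 <= y i <= a i)%N ->
    forall i, (y i < (\sum_(i < n) a i).+1)%N.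
  move=> yP i; rewrite ltnS (bigD1 i) //= (leq_trans _ (leq_addr _ _)) //.
  by have /andP[] := yP i.
have lower (y : 'I_n -> nat) : (forall i, 1 <= y i <= a i)%N ->
    (\sum_(i < n) y i = N)%N ->
    (min_distribution a N%:Z <= \prod_(i < n) y i)%N.
  move=> yP yN; rewrite /min_distribution ltz_nat ltnNge le_nN /=.
  pose z := [ffun i => Ordinal (y_lt y yP i)].
  have zE i : z i = y i :> nat by rewrite ffunE.
  have zP : distribution a N%:Z z.
    apply/andP; split; first by apply/forallP => i; rewrite zE.
    by apply/eqP; congr Posz; rewrite -yN; apply: eq_bigr.
  rewrite (_ : (\prod_(i < n) y i)%N = (\prod_(i < n) z i)%N).
    exact: leq_bigminn.
  by apply: eq_bigr => i _; rewrite zE.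
split=> //.
have [y0 [y0P y0N]] : exists y : 'I_n -> nat,
    (forall i, 1 <= y i <= a i)%N /\ (\sum_(i < n) y i = N)%N.
  have [|y [yP yN]] := @distribution_exists n a (N - n) a_gt0.
    by rewrite subnKC.
  by exists y; rewrite yN subnKC.
have := lower y0 y0P y0N; rewrite /min_distribution ltz_nat ltnNge le_nN /=.
set P := fun m => exists y : 'I_n -> nat,
    [/\ forall i, (1 <= y i <= a i)%N, (\sum_(i < n) y i = N)%N &
        (\prod_(i < n) y i = m)%N].
set m := (X in (X <= _)%N); rewrite -/(P m) => le_m.
have [m_default|//] : m = (\prod_(i < n) a i)%N \/ P m.
  apply: (big_ind (fun m => m = (\prod_(i < n) a i)%N \/ P m)).
  - by left.
  - by move=> x y Px Py; rewrite /minn; case: ifP.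
  - move=> z /andP[/forallP zP /eqP[zN]]; right.
    by exists (fun i => z i).
exists y0; split=> //; apply/eqP; rewrite eqn_leq le_m andbT m_default.
by apply: leq_prod => i _; have /andP[] := y0P i.
Qed.

(* Main.v *)
Require Import Defs.
From HB Require Import structures.
From mathcomp Require Import all_boot all_order all_algebra.
From mathcomp Require Import finmap.
From mathcomp Require Import boolp classical_sets functions cardinality.
From mathcomp Require Import mpoly ring zify.

Set Implicit Arguments.
Unset Strict Implicit.
Unset Printing Implicit Defensive.

Import Order.TTheory GRing.Theory Num.Theory.

Local Open Scope classical_set_scope.
Local Open Scope ring_scope.

(* Alon-Furedi: a polynomial of degree at most d that is not identically zero on
   a grid with sides a_1, ..., a_n has at least prod y_i nonzeros there, for
   some 1 <= y_i <= a_i with sum y_i >= sum a_i - d.  The argument (divide by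
   t_i - a when the slice t_i = a consists of zeros, otherwise add up the
   slices) works over R modulo any ideal J for which the differences of distinct
   elements of A_i are regular, in particular for J = p^(V+1).

   It is applied to the product over j of prod_c (f_j - c), where c runs over
   representatives of the classes modulo p^(v_j) that do not meet B_j, of which
   there are at most q^(v_j) - #B_j.  As the elements of B_j are incongruent
   modulo p, the p-adic valuation of prod_c (y - c) takes its minimum exactly
   when y lies in B_j modulo p^(v_j); if V is the sum of these minima, the product
   is nonzero modulo p^(V+1) exactly on Z.

   Valuations need only the following trace of the localization at p being a
   discrete valuation ring: there are pi in p and u outside p with
   u p contained in pi R.  For p = 0 this holds with pi = 0, and nothing below
   requires p to be nonzero. *)

(** * Ideals given by sets *)

Definition ideal_set (R : comNzRingType) (J : set R) : Prop :=
  J 0 /\ forall a x y, J x -> J y -> J (a * x + y).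

Section IdealSet.
Variables (R : comNzRingType) (J : set R).
Hypothesis J_ideal : ideal_set J.

Lemma ideal_setD x y : J x -> J y -> J (x + y).
Proof. by move=> Jx Jy; rewrite -[x]mul1r; apply: J_ideal.2. Qed.

Lemma ideal_setM a x : J x -> J (a * x).
Proof.
by move=> Jx; rewrite -[_ * _]addr0; apply: J_ideal.2 => //; apply: J_ideal.1.
Qed.

Lemma ideal_setB x y : J x -> J y -> J (x - y).
Proof. by move=> Jx Jy; apply: ideal_setD => //; rewrite -mulN1r; apply: ideal_setM. Qed.

Lemma ideal_setBr x y : J x -> J (x - y) -> J y.
Proof. by move=> Jx Jxy; rewrite -[y](subKr x); apply: ideal_setB. Qed.

Lemma ideal_set_sum (I : Type) (r : seq I) (P : pred I) (g : I -> R) :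
  (forall i, P i -> J (g i)) -> J (\sum_(i <- r | P i) g i).
Proof.
move=> Jg; apply: (big_ind J) => //; [exact: J_ideal.1 | exact: ideal_setD].
Qed.

(** Noetherianity and maximality speak of [idealr]; a proper ideal given as a set becomes one
    through classically decided membership. *)
Lemma idealr_of_set : ~ J 1 -> exists K : idealr R, forall x, (x \in K) <-> J x.
Proof.
move=> J1; pose S := fun x : R => `[< J x >].
have SI : idealr_closed S.
  split; first by apply/asboolP; exact: J_ideal.1.
    by apply/negP => /asboolP.
  by move=> a x y /asboolP Jx /asboolP Jy; apply/asboolP; apply: J_ideal.2.
pose m := isIdealr.Build R S SI.
pose K : idealr R := HB.pack S m.
by exists K => x; split=> /asboolP.
Qed.

End IdealSet.

Lemma ideal_set_idealr (R : comNzRingType) (I : idealr R) : ideal_set [set` I].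
Proof.
split=> [|a x y xI yI]; first exact: rpred0.
by rewrite /=; apply: rpredD => //; rewrite idealMr.
Qed.

Lemma mem_generator (R : comNzRingType) (I : idealr R) k (g : 'I_k -> R) :
  (forall x, x \in I <-> exists c : 'I_k -> R, x = \sum_i c i * g i) ->
  forall i, g i \in I.
Proof.
move=> gP i; apply/gP; exists (fun j => (j == i)%:R).
by rewrite (bigD1 i) //= eqxx mul1r big1 ?addr0 // => j /negbTE ->; rewrite mul0r.
Qed.

Lemma ideal_set_mul (R : comNzRingType) (I J : set R) :
  ideal_set I -> ideal_set (ideal_mul I J).
Proof.
move=> II; split; first by exists 0%N, (fun=> 0), (fun=> 0); split=> [[]|[]|] //; rewrite big_ord0.
move=> c x y [k [a [b [aI bJ ->]]]] [l [a' [b' [aI' bJ' ->]]]].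
exists (k + l)%N.
exists (fun i => match fintype.split i with inl i => c * a i | inr i => a' i end).
exists (fun i => match fintype.split i with inl i => b i | inr i => b' i end).
split=> [i|i|]; try by case: (fintype.split i) => // j; apply: ideal_setM.
rewrite big_split_ord mulr_sumr /=; congr (_ + _); apply: eq_bigr => i _.
  by rewrite (unsplitK (inl i)) mulrA.
by rewrite (unsplitK (inr i)).
Qed.

Lemma ideal_set_exp (R : comNzRingType) (I : set R) k :
  ideal_set I -> ideal_set (ideal_exp I k).
Proof. by move=> II; case: k => [|k]; [split | apply: ideal_set_mul]. Qed.

Lemma ideal_mulM (R : comNzRingType) (I J : set R) x y :
  I x -> J y -> ideal_mul I J (x * y).
Proof.
by move=> xI yJ; exists 1%N, (fun=> x), (fun=> y); split; rewrite ?big_ord1.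
Qed.

Lemma ideal_mul_subl (R : comNzRingType) (I : idealr R) (J : set R) :
  ideal_mul [set` I] J `<=` [set` I].
Proof.
move=> _ [k [a [b [aI _ ->]]]]; apply: ideal_set_sum => [|i _].
  exact: ideal_set_idealr.
by rewrite mulrC; apply: ideal_setM (aI i); exact: ideal_set_idealr.
Qed.

(** * Maximal ideals and inverses modulo their powers *)

Section MaximalIdeal.
Variables (R : comNzRingType) (p : idealr R).
Hypothesis p_maximal : maximal_ideal p.

(** The ideal [p + R s] contains [p] and [s]; were it proper, maximality would put [s] in [p]. *)
Lemma maximal_ideal_inv s : s \notin p -> exists t, 1 - t * s \in p.
Proof.
move=> sp; pose J := [set x | exists t, x - t * s \in p].
have JI : ideal_set J.
  split; first by exists 0; rewrite /= mul0r subr0 rpred0.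
  move=> a x y [t tP] [t' tP']; exists (a * t + t').
  rewrite mulrDl opprD addrACA; apply: rpredD => //.
  by rewrite -mulrA -mulrBr idealMr.
apply: contrapT => J1; have [K KP] := idealr_of_set JI J1.
have /p_maximal : {subset p <= K}.
  by move=> x xp; apply/KP; exists 0; rewrite mul0r subr0.
move=> /(_ s); rewrite (negbTE sp) => /(_ _)/notF; apply; apply/KP.
by exists 1; rewrite mul1r subrr rpred0.
Qed.

Lemma maximal_idealM x y : x \notin p -> y \notin p -> x * y \notin p.
Proof.
move=> xp yp; apply/negP => xyp; have [t tP] := maximal_ideal_inv xp.
case/negP: yp; rewrite -[y](addrNK (t * x * y)) -{1}[y]mul1r -mulrBl.
by apply: rpredD; [rewrite mulrC | rewrite -mulrA]; apply: idealMr.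
Qed.

(** Inverses lift to higher powers: [(1 - t' * s) * (1 - t * s)] is again 1 minus a multiple of
    [s]. *)
Lemma maximal_ideal_exp_inv s k : s \notin p ->
  exists t, ideal_exp [set` p] k (1 - t * s).
Proof.
move=> sp; elim: k => [|k [t tP]]; first by exists 0.
have [t' tP'] := maximal_ideal_inv sp; exists (t' + t - t' * t * s).
set x := (X in ideal_exp _ _ X); have -> : x = (1 - t' * s) * (1 - t * s).
  by rewrite /x; ring.
exact: ideal_mulM.
Qed.

End MaximalIdeal.

(** * A local uniformizer *)

Section Uniformizer.
Variables (R : idomainType) (p : idealr R).
Hypotheses (R_dedekind : dedekind_domain R) (p_maximal : maximal_ideal p).

Let p_mul := maximal_idealM p_maximal.

(* The contraction to [R] of the ideal [(a : b)] of the localization at [p]. *)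
Definition local_colon (a b : R) : set R :=
  [set y | exists s, s \notin p /\ exists w, s * y * b = a * w].

Lemma local_colon_ideal a b : ideal_set (local_colon a b).
Proof.
split; first by exists 1; rewrite idealr1; split=> //; exists 0; ring.
move=> c x y [s [sp [w sw]]] [s' [sp' [w' sw']]].
exists (s * s'); split; first exact: p_mul.
exists (s' * c * w + s * w').
rewrite (_ : _ * b = s' * c * (s * x * b) + s * (s' * y * b)); last by ring.
by rewrite sw sw'; ring.
Qed.

Lemma local_colon_sub a b : ~ local_colon a b 1 -> local_colon a b `<=` [set` p].
Proof.
move=> ab1 y [s [sp [w sw]]] /=; apply: contrapT => /negP yp; apply: ab1.
by exists (s * y); split; [exact: p_mul | exists w; rewrite mulr1].
Qed.

Lemma local_colon_dvd a b x y : local_colon a (x * b) y -> local_colon a b (x * y).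
Proof. by move=> [s [sp [w sw]]]; exists s; split=> //; exists w; rewrite -sw; ring. Qed.

Lemma local_colon_mul a b x : local_colon a b `<=` local_colon a (x * b).
Proof.
move=> y [s [sp [w sw]]]; exists s; split=> //; exists (x * w).
have -> : s * y * (x * b) = x * (s * y * b) by ring.
  by rewrite sw; ring.
Qed.

Lemma chain_finite_sub (T : Type) (S : set T) (J : T -> set R) k (g : 'I_k -> R) :
  total_on S (fun s t => `[< J s `<=` J t >]) -> S !=set0 ->
  (forall i, exists2 t, S t & J t (g i)) ->
  exists2 t, S t & forall i, J t (g i).
Proof.
move=> S_chain [t0 St0]; elim: k g => [|k IHk] g gJ.
  by exists t0 => // -[].
have [t St tP] := IHk (fun i => g (lift ord0 i)) (fun i => gJ _).
have [s Ss sP] := gJ ord0.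
have [/asboolP st|/asboolP ts] := S_chain _ _ Ss St; [exists t | exists s] => // i;
  by case: (unliftP ord0 i) => [j|] ->; auto.
Qed.

(** Zorn's lemma on the [b], preordered by their colon ideals: the union of a chain is proper, hence
    finitely generated, so one member of the chain already contains its generators. *)
Lemma maximal_local_colon a : a \in p -> exists b, ~ local_colon a b 1 /\
  forall b', ~ local_colon a b' 1 -> local_colon a b `<=` local_colon a b' ->
    local_colon a b' `<=` local_colon a b.
Proof.
move=> ap; pose T := {b : R | ~ local_colon a b 1}.
have a1 : ~ local_colon a 1 1.
  move=> [s [sp [w]]]; rewrite !mulr1 => sE; case/negP: sp.
  by rewrite sE mulrC idealMr.
pose J (t : T) := local_colon a (sval t).
pose leT (s t : T) := `[< J s `<=` J t >].
have [] := @ZL_preorder T (exist _ 1 a1) leT.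
- by move=> t; apply/asboolP.
- by move=> r s t /asboolP rs /asboolP st; apply/asboolP; apply: subset_trans st.
- move=> S S_chain; have [[t0 St0]|S0] := pselect (S !=set0); last first.
    by exists (exist _ 1 a1) => s Ss; case: S0; exists s.
  pose U := [set x | exists2 t, S t & J t x].
  have UI : ideal_set U.
    split; first by exists t0 => //; exact: (local_colon_ideal _ _).1.
    move=> c x y [s Ss sx] [t St ty].
    have [/asboolP st|/asboolP ts] := S_chain _ _ Ss St; [exists t | exists s] => //.
      by apply: (local_colon_ideal _ _).2 => //; apply: st.
    by apply: (local_colon_ideal _ _).2 => //; apply: ts.
  have U1 : ~ U 1 by move=> [t _]; exact: (svalP t).
  have [K KU] := idealr_of_set UI U1.
  have [R_noetherian _ _] := R_dedekind.
  have [k [g gP]] := R_noetherian K.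
  have [|i|t St tP] := chain_finite_sub S_chain (g := g).
  + by exists t0.
  + by apply/KU; exact: mem_generator gP i.
  + exists t => s Ss; apply/asboolP => x sx.
    have /KU/gP[c ->] : U x by exists s.
    apply: ideal_set_sum; first exact: local_colon_ideal.
    by move=> i _; apply: ideal_setM => //; exact: local_colon_ideal.
move=> [b b1] bmax; exists b; split=> // b' b'1 bb'.
by have /asboolP := bmax (exist _ b' b'1) (introT (asboolP _) bb').
Qed.

(** A maximal proper colon ideal is prime: if it contains [x * y] but not [x], then the colon ideal
    of [x * b] is proper, no smaller, and contains [y]. Containing [a], it is a nonzero prime, hence
    maximal, and lying in [p] it equals [p]. *)
Lemma local_colon_maximal_ideal a : a \in p -> a != 0 -> exists b,
  ~ local_colon a b 1 /\ [set` p] `<=` local_colon a b.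
Proof.
move=> ap a0; have [b [b1 bmax]] := maximal_local_colon ap; exists b; split=> //.
have [K KP] := idealr_of_set (local_colon_ideal a b) b1.
have K_prime : prime_idealr_closed K.
  move=> x y /KP xy; have [xb|xb] := pselect (local_colon a b x).
    by apply/orP; left; apply/KP.
  apply/orP; right; apply/KP; apply: (bmax (x * b)).
  - by move=> /local_colon_dvd; rewrite mulr1.
  - exact: local_colon_mul.
  - by move: xy => [s [sp [w sw]]]; exists s; split=> //; exists w; rewrite -sw; ring.
pose m := isPrimeIdealrClosed.Build R K K_prime.
pose P : prime_idealr R := HB.pack (Idealr.sort K) (Idealr.class K) m.
have [_ _ R_dim1] := R_dedekind.
have Pmax : maximal_ideal P.
  apply: R_dim1; exists a => //; apply/KP; exists 1; rewrite idealr1; split=> //.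
  by exists b; ring.
move=> x xp; apply/KP; apply: (Pmax p) => // y /KP; exact: local_colon_sub.
Qed.

(** Clears the denominators of [local_colon_maximal_ideal]: the product [t] of those for the
    generators of [p] works for all of [p]. *)
Lemma colon_maximal_ideal a : a \in p -> a != 0 -> exists b,
  ~ (exists w, b = a * w) /\ (forall y, y \in p -> exists w, y * b = a * w).
Proof.
move=> ap a0; have [b [b1 bp]] := local_colon_maximal_ideal ap a0.
have [R_noetherian _ _] := R_dedekind.
have [k [g gP]] := R_noetherian p.
have gp := mem_generator gP.
have [s sP] := choice (fun i => bp _ (gp i)).
pose t := \prod_i s i.
exists (t * b); split=> [[w tw]|y /gP[c ->]].
  apply: b1; exists t; split; last by exists w; rewrite mulr1.
  rewrite /t; apply: (big_ind (fun x => x \notin p)); rewrite ?idealr1 //.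
  by move=> i _; case: (sP i).
apply: (big_ind (fun y => exists w, y * (t * b) = a * w)).
- by exists 0; ring.
- by move=> x z [w wP] [w' wP']; exists (w + w'); rewrite mulrDl wP wP'; ring.
move=> i _; have [_ [w wP]] := sP i.
exists (c i * \prod_(j | j != i) s j * w).
have -> : a * (c i * \prod_(j | j != i) s j * w) = c i * \prod_(j | j != i) s j * (a * w).
  by ring.
by rewrite -wP /t (bigD1 i) //=; ring.
Qed.

(* Determinant trick: if [b / a] maps the finitely generated nonzero module [p]
   into itself, it is integral over [R]. *)
Lemma dvd_of_stable a b : a \in p -> a != 0 ->
  (forall y, y \in p -> exists2 w, w \in p & y * b = a * w) ->
  exists w, b = a * w.
Proof.
move=> ap a0 stab.
have [R_noetherian R_closed _] := R_dedekind.
have [k [g gP]] := R_noetherian p.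
have gp := mem_generator gP.
have /choice[c cP] i : exists c : 'I_k -> R, g i * b = a * \sum_j c j * g j.
  have [w /gP[c cw] ->] := stab _ (gp i).
  by exists c; rewrite cw.
(* Transposed, so that the row of generators is an eigenvector of [M] for [b / a]; it is nonzero
   because [p] contains [a]. *)
pose M : 'M[R]_k := \matrix_(j, i) c i j.
pose fr := @FracField.tofrac R.
have fa0 : fr a != 0 by rewrite tofrac_eq0.
have z_int : integralOver fr (fr b / fr a).
  exists (char_poly M); first exact: char_poly_monic.
  rewrite map_char_poly -eigenvalue_root_char; apply/eigenvalueP.
  exists (\row_i fr (g i)); last first.
    apply: contraNneq a0 => g0; have /gP[d ->] := ap.
    rewrite big1 // => i _; have /rowP/(_ i) := g0; rewrite !mxE => /eqP.
    by rewrite tofrac_eq0 => /eqP ->; rewrite mulr0.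
  apply/rowP => i; rewrite !mxE.
  apply: (mulfI fa0); rewrite mulrA mulrCA divff // mulr1 -tofracM [b * _]mulrC cP.
  rewrite tofracM; congr (_ * _); rewrite rmorph_sum; apply: eq_bigr => j _.
  by rewrite !mxE mulrC -tofracM.
have [w wP] := R_closed _ z_int; exists w; apply/eqP.
by rewrite -tofrac_eq tofracM -wP mulrCA divff // mulr1.
Qed.

(* At [p = 0] the uniformizer is 0. *)
Lemma uniformizer : exists pi u, [/\ pi \in p, u \notin p &
  forall y, y \in p -> exists w, u * y = pi * w].
Proof.
have [[a ap a0]|p0] := pselect (exists2 a, a \in p & a != 0); last first.
  exists 0, 1; split; rewrite ?rpred0 ?idealr1 // => y yp; exists 0.
  rewrite mulr0 mul1r; apply/eqP; apply: contrapT => /negP y0; apply: p0.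
  by exists y.
have [b [ab bp]] := colon_maximal_ideal ap a0.
(* Either [b / a] sends some [x] of [p] to a [u] outside [p], and then [x] is a uniformizer, or it
   maps [p] into itself and the determinant trick makes [a] divide [b]. *)
have [[x [u [xp up xu]]]|stab] :=
    pselect (exists x u, [/\ x \in p, u \notin p & x * b = a * u]).
  exists x, u; split=> // y yp; have [w wP] := bp y yp; exists w.
  have b0 : b != 0 by apply/eqP => b0; apply: ab; exists 0; rewrite b0 mulr0.
  apply: (mulfI b0); have -> : b * (x * w) = x * b * w by ring.
  have -> : b * (u * y) = u * (y * b) by ring.
  by rewrite wP xu; ring.
case: ab; apply: dvd_of_stable => // y yp; have [w wP] := bp y yp.
exists w => //; apply: contrapT => /negP wp; apply: stab.
by exists y, w.
Qed.

End Uniformizer.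

(** * Valuation at a maximal ideal *)

Section Valuation.
Variables (R : idomainType) (p : idealr R) (pi u : R).
Hypotheses (p_maximal : maximal_ideal p) (pi_p : pi \in p) (u_p : u \notin p)
  (pi_gen : forall y, y \in p -> exists w, u * y = pi * w).

Local Notation pow := (ideal_exp [set` p]).

Let p_mul := maximal_idealM p_maximal.

Let pow_ideal k : ideal_set (pow k).
Proof. by apply: ideal_set_exp; exact: ideal_set_idealr. Qed.

(** [p ^ k] is contracted from [pi ^ k] in the localization. One way, [u] clears denominators; the
    other way, if [s x = pi ^ k w] and [t] inverts [s] modulo [p ^ k], both terms of
    [x = x (1 - t s) + t (s x)] lie in [p ^ k]. *)
Lemma ideal_exp_local k : pow k = local_colon p (pi ^+ k) 1.
Proof.
apply/seteqP; split.
  elim: k => [|k IHk] x; first by exists 1; rewrite idealr1; split=> //; exists x; ring.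
  move=> [m [a [b [ap bp ->]]]].
  apply: ideal_set_sum; first exact: local_colon_ideal.
  move=> i _; have [w uw] := pi_gen (ap i).
  have [s [sp [w' sw']]] := IHk _ (bp i).
  exists (u * s); split; first exact: p_mul.
  exists (w * w'); have -> : u * s * (a i * b i) * 1 = (u * a i) * (s * b i * 1) by ring.
  by rewrite uw sw' exprS; ring.
move=> x [s [sp [w]]]; rewrite mulr1 => sw.
have pi_k : pow k (pi ^+ k).
  elim: k {sw} => [//|k IHk]; rewrite exprS; exact: ideal_mulM.
have [t tP] := maximal_ideal_exp_inv p_maximal k sp.
have -> : x = x * (1 - t * s) + t * (s * x) by ring.
by rewrite sw (mulrC (pi ^+ k)); apply: ideal_setD => //; do ?apply: ideal_setM.
Qed.

Lemma ideal_exp_leq k l : (k <= l)%N -> pow l `<=` pow k.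
Proof.
move=> /subnKC <-; rewrite !ideal_exp_local => x [s [sp [w sw]]].
by exists s; split=> //; exists (pi ^+ (l - k) * w); rewrite sw exprD; ring.
Qed.

Lemma ideal_exp_mul k l x y : pow k x -> pow l y -> pow (k + l) (x * y).
Proof.
rewrite !ideal_exp_local => -[s [sp [w sw]]] [t [tp [z tz]]].
exists (s * t); split; first exact: p_mul.
exists (w * z); have -> : s * t * (x * y) * 1 = (s * x * 1) * (t * y * 1) by ring.
by rewrite sw tz exprD; ring.
Qed.

(** [p ^ k] is [p]-primary, which makes differences of incongruent elements regular modulo it. *)
Lemma ideal_exp_unitl k s x : s \notin p -> pow k (s * x) -> pow k x.
Proof.
move=> sp; rewrite !ideal_exp_local => -[t [tp [w tw]]].
by exists (t * s); split; [exact: p_mul | exists w; rewrite -tw; ring].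
Qed.

Lemma ideal_expS_sub k : pow k.+1 `<=` [set` p].
Proof. exact: ideal_mul_subl. Qed.

Lemma ideal_exp_mulN k l x y : pow k x -> ~ pow k.+1 x -> pow l y -> ~ pow l.+1 y ->
  ~ pow (k + l).+1 (x * y).
Proof.
(* In the form [s x = pi ^ k w], the failure of [x \in p ^ k.+1] forces both
   [w \notin p] and [pi ^ k != 0]. *)
have unit_part j z : pow j z -> ~ pow j.+1 z -> exists s w,
    [/\ s \notin p, w \notin p, s * z = pi ^+ j * w & pi ^+ j != 0].
  rewrite !ideal_exp_local => -[s [sp [w]]]; rewrite mulr1 => sw zS.
  exists s, w; split=> //.
    apply/negP => wp; have [w' uw'] := pi_gen wp; apply: zS.
    exists (u * s); split; first exact: p_mul.
    exists w'; have -> : u * s * z * 1 = u * (s * z) by ring.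
    by rewrite sw exprSr -mulrA -uw'; ring.
  apply/eqP => pi0; apply: zS; exists s; split=> //; exists 0.
  by rewrite mulr1 sw pi0; ring.
move=> xk xSk yl ySl.
have [s [w [sp wp sw pik]]] := unit_part _ _ xk xSk.
have [t [z [tp zp tz pil]]] := unit_part _ _ yl ySl.
rewrite ideal_exp_local => -[r [rp [a ra]]].
have /negP[] := p_mul rp (p_mul wp zp).
(* Cancelling [pi ^ (k + l)] leaves a product of elements outside [p] equal to a multiple of
   [pi]. *)
have -> : r * (w * z) = s * t * a * pi.
  apply: (mulfI (mulf_neq0 pik pil)).
  have -> : pi ^+ k * pi ^+ l * (r * (w * z)) = r * (pi ^+ k * w) * (pi ^+ l * z) by ring.
  have -> : pi ^+ k * pi ^+ l * (s * t * a * pi) = s * t * (pi ^+ (k + l).+1 * a).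
    by rewrite exprS exprD; ring.
  by rewrite -sw -tz -ra; ring.
exact: idealMr.
Qed.

(** The valuation capped at [v]: it is finite also at 0 and depends only on the class modulo
    [p ^ v]. *)
Definition valuation_upto v x := (\max_(k < v.+1 | `[< pow k x >]) k)%N.

Lemma valuation_upto_max v k x : (k <= v)%N -> pow k x -> (k <= valuation_upto v x)%N.
Proof.
move=> kv xk; rewrite -ltnS in kv.
by apply: (leq_bigmax_cond (Ordinal kv)); apply/asboolP.
Qed.

Lemma valuation_uptoP v x :
  (valuation_upto v x <= v)%N /\ pow (valuation_upto v x) x.
Proof.
have : (0 < #|[pred k : 'I_v.+1 | `[< pow k x >]]|)%N.
  by apply/card_gt0P; exists ord0; apply/asboolP.
move=> /(eq_bigmax_cond (fun k : 'I_v.+1 => k : nat))[k /asboolP xk].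
by rewrite /valuation_upto => ->; split; rewrite // -ltnS.
Qed.

Lemma valuation_uptoB v x y : pow v (x - y) -> valuation_upto v x = valuation_upto v y.
Proof.
move=> vxy; apply: eq_bigl => k; apply/asboolP/asboolP => h.
  by apply: ideal_setBr h _ => //; apply: ideal_exp_leq vxy; rewrite -ltnS.
rewrite -(subrK y x); apply: ideal_setD => //; apply: ideal_exp_leq vxy.
by rewrite -ltnS.
Qed.

Lemma valuation_upto_eq v x : pow v x -> valuation_upto v x = v.
Proof.
move=> vx; apply/eqP; rewrite eqn_leq (valuation_uptoP v x).1.
exact: valuation_upto_max.
Qed.

Lemma valuation_upto_lt v x : ~ pow v x -> (valuation_upto v x < v)%N.
Proof.
have [le_v vx] := valuation_uptoP v x; rewrite ltn_neqAle le_v andbT => xv.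
by apply/eqP => e; rewrite e in vx.
Qed.

Lemma valuation_upto_eq0 v x : x \notin p -> valuation_upto v x = 0%N.
Proof.
move=> xp; have [_] := valuation_uptoP v x; case: (valuation_upto v x) => // k.
by move=> /ideal_expS_sub /= xp'; rewrite xp' in xp.
Qed.

Lemma valuation_uptoS v x : ~ pow v x -> ~ pow (valuation_upto v x).+1 x.
Proof.
by move=> xv /(valuation_upto_max (valuation_upto_lt xv)); rewrite ltnn.
Qed.

(** Exact valuations add by [ideal_exp_mulN], while a single factor in the next power already lifts
    the whole product by one. *)
Lemma ideal_exp_prod (I : eqType) (s : seq I) (V : I -> nat) (h : I -> R) :
  (forall i, pow (V i) (h i)) ->
  pow (\sum_(i <- s) V i)%N (\prod_(i <- s) h i) /\
  (~ pow (\sum_(i <- s) V i).+1%N (\prod_(i <- s) h i) <->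
   forall i, i \in s -> ~ pow (V i).+1 (h i)).
Proof.
move=> hV; elim: s => [|i s [IH IHN]].
  rewrite !big_nil; split=> //; split=> // _.
  by apply: contra_not (@ideal_expS_sub 0 1) _ => /=; rewrite idealr1.
rewrite !big_cons; split; first exact: ideal_exp_mul.
split=> [N j|N].
  rewrite inE => /predU1P[->|js] Sj; apply: N.
    by rewrite -addSn; apply: ideal_exp_mul.
  rewrite -addnS; apply: ideal_exp_mul => //; apply: contrapT => /IHN.
  by move=> /(_ j js).
apply: ideal_exp_mulN => //; first by apply: N; rewrite mem_head.
by apply/IHN => j js; apply: N; rewrite inE js orbT.
Qed.

End Valuation.

(** * Residue classes modulo powers of [p] *)

Section Residues.
Variables (R : idomainType) (p : idealr R) (pi u : R).
Hypotheses (p_maximal : maximal_ideal p) (pi_p : pi \in p) (u_p : u \notin p)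
  (pi_gen : forall y, y \in p -> exists w, u * y = pi * w).
Variables (F : finType) (psi : F -> R).
Hypothesis psi_complete : forall x, exists c, x - psi c \in p.

Local Notation pow := (ideal_exp [set` p]).
Local Notation val_upto := (valuation_upto p).

Let pow_ideal k : ideal_set (pow k).
Proof. by apply: ideal_set_exp; exact: ideal_set_idealr. Qed.

(** Digit expansion to base [pi]: [psi c] is the lowest digit, and [t], an inverse of [u] modulo
    [p ^ k], turns the rest into [pi (t w)] modulo [p ^ (k + 1)]. *)
Lemma ideal_exp_complete k : exists (I : finType) (C : I -> R),
  #|I| = (#|F| ^ k)%N /\ forall x, exists i, pow k (x - C i).
Proof.
elim: k => [|k [I [C [cardI IP]]]].
  by exists unit, (fun=> 0); rewrite card_unit; split=> // x; exists tt.
exists (F * I)%type, (fun ci => psi ci.1 + pi * C ci.2).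
rewrite card_prod cardI expnS; split=> // x.
have [c xc] := psi_complete x; have [w uw] := pi_gen xc.
have [t tP] := maximal_ideal_exp_inv p_maximal k u_p.
have [i iP] := IP (t * w); exists (c, i) => /=.
have -> : x - (psi c + pi * C i) = (x - psi c) * (1 - t * u)
    + pi * (t * w - C i) + t * (u * (x - psi c) - pi * w) by ring.
rewrite uw subrr mulr0 addr0.
by apply: (ideal_setD (pow_ideal k.+1)); apply: ideal_mulM.
Qed.

(** A complete system may list a class repeatedly. [xchoose] depends only on the predicate, hence on
    the class, so keeping the indices with [cl (C i) = i] leaves one per class. *)
Lemma ideal_exp_classes k : exists (I : finType) (rep : I -> R) (cl : R -> I),
  [/\ (#|I| <= #|F| ^ k)%N, forall x y, cl x = cl y <-> pow k (x - y) &
      forall i, cl (rep i) = i].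
Proof.
have [I [C [cardI CP]]] := ideal_exp_complete k.
have Cb x : exists i, `[< pow k (x - C i) >].
  by have [i xi] := CP x; exists i; apply/asboolP.
pose cl x := xchoose (Cb x).
have clP x : pow k (x - C (cl x)) by apply/asboolP; exact: (xchooseP (Cb x)).
have cl_eq x y : cl x = cl y <-> pow k (x - y).
  split=> [e|xy].
    have -> : x - y = (x - C (cl x)) - (y - C (cl y)) by rewrite e; ring.
    exact: ideal_setB.
  apply: eq_xchoose => i; apply/asboolP/asboolP => h.
    have -> : y - C i = (x - C i) - (x - y) by ring.
    exact: ideal_setB.
  have -> : x - C i = (y - C i) + (x - y) by ring.
  exact: ideal_setD.
have cl_good x : cl (C (cl x)) == cl x.
  by apply/eqP; apply/cl_eq; rewrite -opprB -mulN1r; apply: ideal_setM.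
exists {i : I | cl (C i) == i}, (fun i => C (sval i)), (fun x => exist _ (cl x) (cl_good x)).
split=> [|x y|i].
- by rewrite card_sig -cardI max_card.
- by rewrite -cl_eq; split=> [[]|e] //; apply: val_inj.
- by apply: val_inj => /=; apply/eqP; exact: (valP i).
Qed.

(* [y] lies in [B] modulo [p ^ v] iff the product of [y - c], over
   representatives [c] of the classes modulo [p ^ v] missing [B], has minimal
   valuation: all classes together contribute a constant, to which those of [B]
   contribute [v] if [y] lies in [B] modulo [p ^ v], and less otherwise. *)
Lemma separating_product v (B : seq R) : (0 < v)%N -> uniq B ->
  (forall b b', b \in B -> b' \in B -> b - b' \in p -> b = b') ->
  exists (S : seq R) (V : nat), (size S + size B <= #|F| ^ v)%N /\
    forall y, pow V (\prod_(c <- S) (y - c)) /\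
      (~ pow V.+1 (\prod_(c <- S) (y - c)) <-> exists2 b, b \in B & pow v (y - b)).
Proof.
move=> v_gt0 uB B_inc.
have [I [rep [cl [cardI clE clK]]]] := ideal_exp_classes v.
have rep_cl x : pow v (rep (cl x) - x) by apply/clE.
have pow_p x : pow v x -> x \in p 
  by move/(ideal_exp_leq p_maximal pi_p u_p pi_gen v_gt0)/ideal_expS_sub.
have cl_injB : {in B &, injective cl}.
  by move=> b b' bB b'B /clE/pow_p; exact: B_inc.
pose T : pred I := [pred i | i \notin map cl B].
pose val y i := val_upto v (y - rep i).
pose W := (\sum_i val_upto v (rep i))%N.
have WE y : (\sum_i val y i = W)%N.
  (* As [i] runs over all classes, so does the class of [y - rep i]; the sum therefore does not
     depend on [y]. *)
  pose h i := cl (y - rep i).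
  have h_inj : injective h.
    move=> i j /clE ij; rewrite -(clK i) -(clK j); apply/esym/clE.
    by have -> : rep j - rep i = y - rep i - (y - rep j) by ring.
  rewrite /W [RHS](reindex_inj h_inj) /=; apply: eq_bigr => i _; apply: esym.
  apply: (valuation_uptoB p_maximal pi_p u_p pi_gen).
  exact: rep_cl.
have W_split y : (\sum_(i | T i) val y i + \sum_(b <- B) val_upto v (y - b) = W)%N.
  rewrite -(WE y) [RHS](bigID T) /=; congr (_ + _)%N.
  rewrite (eq_bigl (mem (map cl B))) => [|i]; last by rewrite negbK.
  rewrite -big_uniq ?map_inj_in_uniq //= big_map.
  apply: eq_bigr => b _; apply: (valuation_uptoB p_maximal pi_p u_p pi_gen).
  have -> : y - b - (y - rep (cl b)) = rep (cl b) - b by ring.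
  exact: rep_cl.
have val0 x : pow v x -> val_upto v x = v by exact: valuation_upto_eq.
(* For [y = 0] the class of 0 alone contributes [v], so the subtraction in [W - v] is not
   truncated. *)
have vW : (v <= W)%N.
  rewrite -(WE 0) (bigD1 (cl 0)) //= /val.
  rewrite val0 ?leq_addr // (_ : 0 - rep (cl 0) = -1 * (rep (cl 0) - 0)); last by ring.
  by apply: ideal_setM.
pose beta y := (\sum_(b <- B) val_upto v (y - b))%N.
(* At most one element of [B] is congruent to [y] modulo [p]; the others contribute 0. *)
have beta1 y b : b \in B -> y - b \in p -> beta y = val_upto v (y - b).
  move=> bB yb; rewrite /beta (bigD1_seq b) //= big1_seq ?addn0 // => b' /andP[b'b b'B].
  apply: valuation_upto_eq0; apply: contraNN b'b => yb'.
  apply/eqP; apply: B_inc => //.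
  have -> : b' - b = y - b - (y - b') by ring.
  exact: rpredB.
have beta_eq y b : b \in B -> pow v (y - b) -> beta y = v.
  by move=> bB yb; rewrite (beta1 _ b) ?val0 //; exact: pow_p.
have beta_lt y : ~ (exists2 b, b \in B & pow v (y - b)) -> (beta y < v)%N.
  move=> yB; have [[b bB yb]|yBp] := pselect (exists2 b, b \in B & y - b \in p).
    by rewrite (beta1 _ b) //; apply: valuation_upto_lt => yb'; apply: yB; exists b.
  rewrite /beta big1_seq // => b /= bB; apply: valuation_upto_eq0.
  by apply/negP => yb; apply: yBp; exists b.
exists [seq rep i | i <- enum T], (W - v)%N; split.
  rewrite size_map -cardE -(size_map cl) -(card_uniqP _) ?map_inj_in_uniq //.
  by rewrite addnC (leq_trans _ cardI) // cardC.
move=> y.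
have val_pow i : pow (val y i) (y - rep i) by exact: (valuation_uptoP _ _ _).2.
have [] := ideal_exp_prod p_maximal pi_p u_p pi_gen (enum T) val_pow.
rewrite big_map !big_enum /= => prod_pow prod_powN.
have sumE : (\sum_(i | T i) val y i = W - beta y)%N.
  by rewrite -(W_split y) addnK.
rewrite sumE in prod_pow prod_powN.
have [[b bB yb]|yB] := pselect (exists2 b, b \in B & pow v (y - b)).
  rewrite (beta_eq y b) // in prod_pow prod_powN.
  split=> //; split=> // _; last apply/prod_powN; first by exists b.
  (* The cap at [v] is not reached here: [y - rep i] in [p ^ v] would place [i] among the classes of
     [B]. *)
  move=> i; rewrite mem_enum => iT.
  apply: valuation_uptoS => // yi.
  case/negP: iT; apply/mapP; exists b => //; rewrite -(clK i); apply/clE.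
  have -> : rep i - b = y - b - (y - rep i) by ring.
  exact: ideal_setB.
(* Otherwise [beta y < v], and the lower bound by capped valuations suffices to reach the next
   power. *)
have lt_v := beta_lt y yB.
have VS : pow (W - v).+1 (\prod_(i | T i) (y - rep i)).
  by apply: (ideal_exp_leq p_maximal pi_p u_p pi_gen) prod_pow; lia.
split; first by apply: (ideal_exp_leq p_maximal pi_p u_p pi_gen) VS.
by split=> // nVS; case: nVS.
Qed.

End Residues.

(** * The Alon-Furedi bound modulo an ideal *)

Lemma msizeM_leq (R : idomainType) n (f g : {mpoly R[n]}) a b :
  (msize f <= a.+1)%N -> (msize g <= b)%N -> (msize (f * g) <= a + b)%N.
Proof.
move=> fa gb; have [->|f0] := eqVneq f 0; first by rewrite mul0r msize0.
have [->|g0] := eqVneq g 0; first by rewrite mulr0 msize0.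
rewrite msizeM //; lia.
Qed.

Lemma msizeD_leq (R : nzRingType) n (f g : {mpoly R[n]}) a :
  (msize f <= a)%N -> (msize g <= a)%N -> (msize (f + g) <= a)%N.
Proof.
by move=> fa ga; apply: leq_trans (msizeD_le _ _) _; rewrite geq_max fa ga.
Qed.

Section AlonFuredi.
Variables (R : idomainType) (n : nat).
Implicit Types (f g : {mpoly R[n]}) (x : {ffun 'I_n -> R}) (A : 'I_n -> seq R).

Definition ffun_upd (T : Type) (x : {ffun 'I_n -> T}) i a :=
  [ffun j => if j == i then a else x j].

(** Division of [f] by [t_i - a] with the slice as remainder, recorded on values. It is done for
    monomials by splitting off one variable at a time and extended linearly. *)
Lemma mpoly_slice_quotient (i : 'I_n) (a : R) d f : (msize f <= d.+1)%N ->
  exists g, (msize g <= d)%N /\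
    forall x, f.@[x] - f.@[ffun_upd x i a] = (x i - a) * g.@[x].
Proof.
pose P d f := exists g, (msize g <= d)%N /\
  forall x, f.@[x] - f.@[ffun_upd x i a] = (x i - a) * g.@[x].
have PX m : P (mdeg m) 'X_[m].
  elim: {m}(mdeg m) {-2}m (erefl (mdeg m)) => [|e IH] m.
    move=> /eqP; rewrite mdeg_eq0 => /eqP ->.
    by exists 0; rewrite msize0; split=> // x; rewrite mpolyX0 !meval1 meval0; ring.
  move=> me; have [j mj] : exists j, m j != 0%N.
    apply/existsP; rewrite -negb_forall; apply/negP => /forallP m0.
    suff: mdeg m = 0%N by rewrite me.
    by rewrite mdegE big1 // => j _; apply/eqP.
  rewrite -lep1mP in mj; move/submK: mj me => <-.
  move: (m - U_(j))%MM => {}m; rewrite mdegD mdeg1 addn1 => -[me].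
  have [g [ge gP]] := IH m me; rewrite /P mpolyXD.
  have [ij|ij] := eqVneq j i.
    exists ('X_[m] + a%:MP * g); split=> [|x].
      apply: msizeD_leq; first by rewrite msizeX me.
      by apply: (@msizeM_leq _ _ _ _ 1) => //; rewrite msizeC; case: eqP.
    rewrite !mevalM !mevalXU mevalD mevalM mevalC ffunE ij eqxx.
    have -> : 'X_[m].@[x] * x i - 'X_[m].@[ffun_upd x i a] * a =
      (x i - a) * 'X_[m].@[x] + a * ('X_[m].@[x] - 'X_[m].@[ffun_upd x i a]) by ring.
    by rewrite gP; ring.
  exists ('X_j * g); split=> [|x].
    by apply: (@msizeM_leq _ _ _ _ 1) => //; rewrite msizeX mdeg1.
  rewrite !mevalM !mevalXU ffunE (negbTE ij).
  have -> : 'X_[m].@[x] * x j - 'X_[m].@[ffun_upd x i a] * x j =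
    x j * ('X_[m].@[x] - 'X_[m].@[ffun_upd x i a]) by ring.
  by rewrite gP; ring.
move=> fd; rewrite -/(P d f) [f]mpolyE big_seq.
apply: (big_ind (P d)) => [|f1 f2 [g1 [s1 P1]] [g2 [s2 P2]]|m mf].
- by exists 0; rewrite msize0; split=> // x; rewrite !meval0; ring.
- exists (g1 + g2); split=> [|x]; first exact: msizeD_leq.
  by rewrite !mevalD mulrDr -P1 -P2; ring.
have [g [sg gP]] := PX m; exists (f@_m *: g); split=> [|x].
  apply: leq_trans (msizeZ_le _ _) _; apply: leq_trans sg _.
  by rewrite -ltnS (leq_trans _ fd) // msize_mdeg_lt.
by rewrite !mevalZ -mulrBr gP; ring.
Qed.

Definition seq_upd A i (L : seq R) : 'I_n -> seq R := fun j => if j == i then L else A j.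

Lemma sum_seq_upd A i L :
  (\sum_j size (seq_upd A i L j) = size L + \sum_(j | j != i) size (A j))%N.
Proof.
rewrite (bigD1 i) //= /seq_upd eqxx; congr (_ + _)%N.
by apply: eq_bigr => j /negbTE ->.
Qed.

(* Of the [y] given by the slices, one minimizing [w] serves all of them. *)
Lemma glue_slices (i : 'I_n) (Y : ('I_n -> nat) -> Prop) (G : {ffun 'I_n -> R} -> Prop)
    (w : ('I_n -> nat) -> nat) (L : seq R) :
  uniq L -> L != [::] ->
  (forall a, a \in L -> exists y (s : seq {ffun 'I_n -> R}), [/\ Y y, uniq s,
     forall x, x \in s -> x i = a /\ G x & (w y <= size s)%N]) ->
  exists y (s : seq {ffun 'I_n -> R}), [/\ Y y, uniq s,
     forall x, x \in s -> x i \in L /\ G x & (size L * w y <= size s)%N].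
Proof.
elim: L => // a L IH /= /andP[aL uL] _ LP.
have [y [s [Yy us sP ws]]] := LP a (mem_head _ _).
have [L0|Ln0] := eqVneq L [::].
  exists y, s; split=> //; last by rewrite L0 mul1n.
  by move=> x /sP[<- Gx]; rewrite mem_head.
have [b bL|y' [s' [Yy' us' sP' ws']]] := IH uL Ln0.
  by apply: LP; rewrite inE bL orbT.
have us_cat : uniq (s ++ s').
  rewrite cat_uniq us us' andbT /=; apply/hasPn => x /sP'[xL _].
  by apply: contra aL => /sP[<- _].
have sP_cat x : x \in s ++ s' -> x i \in a :: L /\ G x.
  rewrite mem_cat inE => /orP[/sP[-> Gx]|/sP'[-> Gx]]; rewrite ?eqxx ?orbT //.
have [le_w|/ltnW le_w] := leqP (w y) (w y').
  exists y, (s ++ s'); split=> //; rewrite size_cat mulSn leq_add //.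
  by rewrite (leq_trans _ ws') // leq_mul2l le_w orbT.
exists y', (s ++ s'); split=> //; rewrite size_cat mulSn leq_add //.
exact: leq_trans ws.
Qed.

Variable J : set R.
Hypothesis J_ideal : ideal_set J.

(** Induction on the sum of the sides: one case removes [a] from [A i], the other cuts [A i] down to
    [[:: a]], which is smaller since [A i] is chosen with at least two elements. *)
Lemma alon_furedi (d : nat) f A : (msize f <= d.+1)%N ->
  (forall i, uniq (A i)) ->
  (forall i a b c, a \in A i -> b \in A i -> a != b -> J ((a - b) * c) -> J c) ->
  (exists x, (forall i, x i \in A i) /\ ~ J f.@[x]) ->
  exists (y : 'I_n -> nat) (s : seq {ffun 'I_n -> R}),
    [/\ forall i, (1 <= y i <= size (A i))%N,
        (\sum_i size (A i) <= \sum_i y i + d)%N, uniq s,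
        forall x, x \in s -> (forall i, x i \in A i) /\ ~ J f.@[x] &
        (\prod_i y i <= size s)%N].
Proof.
have [N] := ubnP (\sum_i size (A i))%N.
elim: N d f A => // N IH d f A; rewrite ltnS => A_N fd uA A_reg [x0 [x0A x0J]].
have A_gt0 i : (0 < size (A i))%N by case: (A i) (x0A i).
have [[i Ai]|Ale1] := pselect (exists i, (1 < size (A i))%N); last first.
  exists (fun=> 1%N), [:: x0]; split=> //.
  - apply: leq_trans (leq_addr _ _); apply: leq_sum => i _.
    by rewrite leqNgt; apply/negP => Ai; apply: Ale1; exists i.
  - by move=> x; rewrite inE => /eqP ->.
  - by rewrite big1.
have sumA : (\sum_j size (A j) = size (A i) + \sum_(j | j != i) size (A j))%N.
  by rewrite (bigD1 i).
have upd_sub L : {subset L <= A i} -> forall j, {subset seq_upd A i L j <= A j}.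
  by move=> LA j a; rewrite /seq_upd; case: eqP => [->|] //; exact: LA.
have upd_reg L : {subset L <= A i} ->
    forall j a b c, a \in seq_upd A i L j -> b \in seq_upd A i L j -> a != b ->
    J ((a - b) * c) -> J c.
  by move=> LA j a b c /(upd_sub L LA) aj /(upd_sub L LA) bj; exact: A_reg aj bj.
have upd_uniq L : uniq L -> forall j, uniq (seq_upd A i L j).
  by move=> uL j; rewrite /seq_upd; case: eqP.
have [[a aA aJ]|slices] := pselect (exists2 a, a \in A i &
    forall x, (forall j, x j \in A j) -> x i = a -> J f.@[x]).
  have [g [gd gP]] := mpoly_slice_quotient i a fd.
  have grid_upd x : (forall j, x j \in A j) -> forall j, ffun_upd x i a j \in A j.
    by move=> xA j; rewrite ffunE; case: eqP => // ->.
  have fupd x : (forall j, x j \in A j) -> J f.@[ffun_upd x i a].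
    by move=> xA; apply: aJ; [exact: grid_upd | rewrite ffunE eqxx].
  case: d fd gd => [|d] fd gd.
    (* In degree 0 the quotient vanishes, so [f] takes at [x0] its value on the slice, which lies in
       [J]. *)
    move: gd; rewrite leqn0 msize_poly_eq0 => /eqP g0; case: x0J.
    have := gP x0; rewrite g0 meval0 mulr0 => /eqP; rewrite subr_eq0 => /eqP ->.
    exact: fupd.
  pose L := rem a (A i).
  have LA : {subset L <= A i} by exact: mem_rem.
  have sizeL : size (A i) = (size L).+1 by rewrite size_rem // prednK.
  (* Off the slice, [x i - a] is regular modulo [J], so [f] and [g] have the same zeros there. *)
  have gf x : (forall j, x j \in seq_upd A i L j) -> J f.@[x] <-> J g.@[x].
    move=> xL; have xA j : x j \in A j by apply: upd_sub (xL j).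
    have xia : x i != a.
      by have := xL i; rewrite /seq_upd eqxx mem_rem_uniq // inE => /andP[].
    split=> [fx|gx].
      apply: (A_reg i (x i) a) => //; rewrite -gP.
      by apply: ideal_setB => //; exact: fupd.
    rewrite -(subrK f.@[ffun_upd x i a] f.@[x]) gP.
    by apply: ideal_setD => //; [exact: ideal_setM | exact: fupd].
  have x0L j : x0 j \in seq_upd A i L j.
    rewrite /seq_upd; case: eqP => // ->; rewrite mem_rem_uniq // inE x0A andbT.
    by apply/eqP => x0a; case: x0J; apply: aJ.
  have [||||y [s [yA ysum us sP ys]]] := IH d g (seq_upd A i L) _ gd.
  - by rewrite sum_seq_upd; move: A_N; rewrite sumA sizeL.
  - by apply: upd_uniq; exact: rem_uniq.
  - exact: upd_reg.
  - by exists x0; split=> // /(gf x0 x0L).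
  exists y, s; split=> //.
  - move=> j; have /andP[-> yj] := yA j; rewrite (leq_trans yj) //.
    by rewrite /seq_upd; case: eqP => // ->; rewrite sizeL.
  - by move: ysum; rewrite sum_seq_upd sumA sizeL addSn addnS ltnS.
  - move=> x /sP[xL xg]; split=> [j|]; first exact: upd_sub (xL j).
    by move/(gf x xL).
(* [Y] constrains only the coordinates other than [i]: each slice has [y i = 1], and adding up the
   slices replaces this by [size (A i)]. *)
pose Y (y : 'I_n -> nat) := (forall j, j != i -> 1 <= y j <= size (A j))%N /\
  (\sum_(j | j != i) size (A j) <= \sum_(j | j != i) y j + d)%N.
pose G x := (forall j, x j \in A j) /\ ~ J f.@[x].
pose w (y : 'I_n -> nat) := (\prod_(j | j != i) y j)%N.
have [|a aA|y [s [[yA ysum] us sP ys]]] := @glue_slices i Y G w (A i) (uA i).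
- by rewrite -size_eq0 -lt0n A_gt0.
- have aL : {subset [:: a] <= A i} by move=> b; rewrite inE => /eqP ->.
  have [||||y [s [yA ysum us sP ys]]] := IH d f (seq_upd A i [:: a]) _ fd.
  + by apply: leq_trans A_N; rewrite sum_seq_upd sumA ltn_add2r.
  + exact: upd_uniq.
  + exact: upd_reg.
  + apply: contrapT => noslice; apply: slices; exists a => // x xA xa.
    apply: contrapT => xJ; apply: noslice; exists x; split=> // j.
    by rewrite /seq_upd; case: eqP => // ->; rewrite xa inE.
  have yi : y i = 1%N.
    by have := yA i; rewrite /seq_upd eqxx /= => /andP[y1 y2]; apply/eqP; rewrite eqn_leq y2.
  exists y, s; split=> //.
  + split=> [j ji|]; first by have := yA j; rewrite /seq_upd (negbTE ji).
    by move: ysum; rewrite sum_seq_upd [X in (_ <= X + _)%N -> _](bigD1 i) //= yi -addnA leq_add2l.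
  + move=> x /sP[xA xJ]; split; last by split=> // j; exact: upd_sub (xA j).
    by have := xA i; rewrite /seq_upd eqxx inE => /eqP.
  + by move: ys; rewrite (bigD1 i) //= yi mul1n.
have yE (j : 'I_n) : j != i -> (if j == i then size (A i) else y j) = y j.
  by move=> /negbTE ->.
exists (fun j => if j == i then size (A i) else y j), s; split=> //.
- by move=> j; case: eqP => [->|/eqP /yA //]; rewrite A_gt0 leqnn.
- rewrite sumA [X in (_ <= X + _)%N](bigD1 i) //= eqxx (eq_bigr _ yE) -addnA.
  by rewrite leq_add2l.
- by move=> x /sP[].
- by rewrite (bigD1 i) //= eqxx (eq_bigr _ yE).
Qed.

End AlonFuredi.

(** * From the Alon-Furedi bound to the count of solutions *)

(** [y] is lowered to a [z] with sum exactly [N], by [distribution_exists] with [y] as upper bounds;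
    [z] is admissible for [a] and its product is no larger. For [N < n] the minimum is 1 and the
    [y i] are positive. *)
Lemma min_distribution_le n (a y : 'I_n -> nat) (N : int) :
  (forall i, 1 <= y i <= a i)%N -> N <= (\sum_i y i)%N%:Z ->
  (min_distribution a N <= \prod_i y i)%N.
Proof.
move=> yP Ny; have y_gt0 i : (0 < y i)%N by case/andP: (yP i).
have [Nn|nN] := ltrP N n%:Z.
  by rewrite /min_distribution Nn prodn_gt0.
case: N Ny nN => // N; rewrite !lez_nat => Ny nN.
have [|z [zP zN]] := @distribution_exists n y (N - n) y_gt0; first by rewrite subnKC.
rewrite subnKC // in zN.
have a_gt0 i : (0 < a i)%N by case/andP: (yP i) => y1; exact: leq_trans.
have le_ya : (\sum_i y i <= \sum_i a i)%N by apply: leq_sum => i _; case/andP: (yP i).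
have [|_ min_le] := @min_distributionP n a N a_gt0; first by rewrite nN (leq_trans Ny).
apply: leq_trans (min_le z _ zN) _ => [i|].
  have /andP[z1 zy] := zP i; rewrite z1 (leq_trans zy) //; by case/andP: (yP i).
by apply: leq_prod => i _; case/andP: (zP i).
Qed.

Lemma msize_prod_leq (R : idomainType) n (I : Type) (s : seq I) (d : I -> nat)
    (g : I -> {mpoly R[n]}) : (forall i, msize (g i) <= (d i).+1)%N ->
  (msize (\prod_(i <- s) g i) <= (\sum_(i <- s) d i).+1)%N.
Proof.
move=> gd; elim/big_rec2: _ => [|i e h _ he]; first by rewrite msize1.
by rewrite -addnS; apply: msizeM_leq.
Qed.

Theorem theorem1p7 (R : idomainType) (p : idealr R) (q : nat)
    (F : finFieldType) (phi : {rmorphism {ideal_quot p} -> F})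
    (n r : nat) (v : 'I_r -> nat)
    (A : 'I_n -> set R) (B : 'I_r -> set R) (f : 'I_r -> {mpoly R[n]})
    (R_dedekind : dedekind_domain R)
    (p_maximal : maximal_ideal p)
    (F_card : #|F| = q)
    (phi_iso : bijective phi)
    (n_gt0 : (0 < n)%N) (r_gt0 : (0 < r)%N)
    (v_gt0 : forall j, (0 < v j)%N)
    (A_nonempty : forall i, A i !=set0)
    (B_nonempty : forall j, B j !=set0)
    (A_incongruent : forall i, incongruent p (A i))
    (B_incongruent : forall j, incongruent p (B j)) :
  let Z := solutions p v A B f in
  set_card Z = 0%N \/
  (min_distribution (fun i => set_card (A i))
     (\sum_(i < n) (set_card (A i))%:Z
      - \sum_(j < r) ((q ^ v j)%N%:Z - (set_card (B j))%:Z) * (mdegree (f j))%:Z)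
   <= set_card Z)%N.
Proof.
move=> Z; have phi_inj := bij_inj phi_iso.
have finZ : finite_set Z by exact: finite_solutions phi_inj A_incongruent.
have finA i : finite_set (A i) by exact: finite_incongruent phi_inj (A_incongruent i).
have finB j : finite_set (B j) by exact: finite_incongruent phi_inj (B_incongruent j).
have [[x0 Zx0]|Z0] := pselect (Z !=set0); last first.
  left; rewrite /set_card (_ : Z = set0) ?fset_set0 ?cardfs0 //.
  by apply/seteqP; split=> // x Zx; case: Z0; exists x.
right.
have [pi [u [pi_p u_p pi_gen]]] := uniformizer R_dedekind p_maximal.
have pow_ideal k : ideal_set (ideal_exp [set` p] k).
  by apply: ideal_set_exp; exact: ideal_set_idealr.
have [psi phiK psiK] := phi_iso.
have psi_complete x : exists c, x - repr (psi c) \in p.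
  exists (phi (\pi_({ideal_quot p})%qT x)).
  by rewrite Quotient.idealrBE reprK phiK.
have memA i x : (x \in (fset_set (A i) : seq R)) <-> A i x.
  by rewrite -[_ \in _]/(x \in fset_set (A i)) in_fset_set // inE.
have memB j x : (x \in (fset_set (B j) : seq R)) <-> B j x.
  by rewrite -[_ \in _]/(x \in fset_set (B j)) in_fset_set // inE.
have /choice[SV SVP] j : exists SV : seq R * nat,
    (size SV.1 + set_card (B j) <= q ^ v j)%N /\
    forall y, ideal_exp [set` p] SV.2 (\prod_(c <- SV.1) (y - c)) /\
      (~ ideal_exp [set` p] SV.2.+1 (\prod_(c <- SV.1) (y - c)) <->
       in_mod y (B j) (ideal_exp [set` p] (v j))).
  have [|S [V [SB SP]]] := separating_product p_maximal pi_p u_p pi_gen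
      psi_complete (v_gt0 j) (fset_uniq (fset_set (B j))).
    move=> b b' /memB Bb /memB Bb'; exact: (B_incongruent j).
  exists (S, V); rewrite -F_card; split=> // y; have [yV yB] := SP y.
  split=> //; apply: iff_trans yB _.
  by split=> -[b /memB Bb yb]; exists b.
pose S j := (SV j).1; pose V j := (SV j).2.
pose h j := \prod_(c <- S j) (f j - c%:MP).
pose Q := \prod_(j <- enum 'I_r) h j.
have hE j (x : {ffun 'I_n -> R}) : (h j).@[x] = \prod_(c <- S j) ((f j).@[x] - c).
  rewrite rmorph_prod; apply: eq_bigr => c _.
  by rewrite /= mevalB mevalC.
pose J := ideal_exp [set` p] (\sum_(j <- enum 'I_r) V j).+1.
have QZ (x : {ffun 'I_n -> R}) : (forall i, A i (x i)) -> ~ J Q.@[x] <-> Z x.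
  move=> xA; have hV j : ideal_exp [set` p] (V j) (h j).@[x].
    by rewrite hE; have [_ /(_ (f j).@[x])[]] := SVP j.
  have [_] := ideal_exp_prod p_maximal pi_p u_p pi_gen (enum 'I_r) hV.
  rewrite -rmorph_prod => QE; apply: iff_trans QE _; split=> [hN|[_ xB] j _].
    split=> // j; have [_ /(_ (f j).@[x])[_ <-]] := SVP j.
    by rewrite -hE; apply: hN; rewrite mem_enum.
  by rewrite hE; have [_ /(_ (f j).@[x])[_ ->]] := SVP j.
pose d := (\sum_(j <- enum 'I_r) size (S j) * mdegree (f j))%N.
have Qd : (msize Q <= d.+1)%N.
  apply: msize_prod_leq => j.
  rewrite -sum1_size big_distrl /=; apply: msize_prod_leq => c; rewrite mul1n.
  (* [(mdegree (f j)).+1] is at least 1 even for [f j = 0], so it also bounds the size of the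
     constant [c]. *)
  by apply: msizeD_leq; rewrite ?leqSpred // mmeasureN msizeC; case: eqP.
have [||y [s [yA ysum us sP ys]]] := @alon_furedi R n J (pow_ideal _) d Q
    (fun i => fset_set (A i)) Qd (fun i => fset_uniq _).
- move=> i a b c /memA Aa /memA Ab ab; apply: (ideal_exp_unitl p_maximal pi_p u_p pi_gen).
  by apply: contra ab => abp; apply/eqP; exact: A_incongruent Aa Ab abp.
- by exists x0; split=> [i|]; [apply/memA; exact: Zx0.1 | apply/QZ => //; exact: Zx0.1].
apply: (@leq_trans (size s)); last first.
  apply: uniq_leq_size us _ => x /sP[xA xQ].
  rewrite -[_ \in _]/(x \in fset_set Z) in_fset_set // inE.
  by apply/QZ => // i; apply/memA.
apply: leq_trans ys; apply: min_distribution_le => //.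
(* The size of [S j] is only bounded above, so [d] may be smaller than the degree sum of the
   statement; [min_distribution_le] absorbs the slack. *)
have le_d : d%:Z <= \sum_(j < r) ((q ^ v j)%N%:Z - (set_card (B j))%:Z) * (mdegree (f j))%:Z.
  rewrite /d big_enum /= -natz natr_sum; apply: ler_sum => j _.
  rewrite natz PoszM ler_wpM2r // lerBrDr -PoszD lez_nat.
  by case: (SVP j).
have sumA : \sum_(i < n) (set_card (A i))%:Z = (\sum_i size (fset_set (A i)))%N%:Z.
  by rewrite -[RHS]natz natr_sum; apply: eq_bigr => i _; rewrite natz.
rewrite sumA lerBlDr (@le_trans _ _ (\sum_i y i + d)%N%:Z) ?lez_nat //.
by rewrite PoszD lerD2l.
Qed.
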